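(* Let $d\geqslant 2$ be an even integer and $e$ an indeterminate. Let $n$ be a positive integer with $n\equiv d+1\pmod{2d}$. Let $M=(n-1)/2$ if $d=2$, and $M=(dn-n+1)/(2d)$ otherwise. Then \[ \sum_{k=0}^{M}[3dk-1]\frac{(q^{-1},e,q^{d-1}/e; q^{2d})_{k}\,(q,q,q^{d-3};q^{d})_{k}\, q^{dk} } {(q^{d},e,q^{d-1}/e;q^{d})_{k}\,(q^{2d-2}, q^{2d-2},q^{d+2};q^{2 d})_{k} } \equiv 0 \pmod{\Phi_n(q)^3}. \]
   Context: For an expression $x$ and a base $p$, $(x;p)_k=(1-x)(1-xp)\cdots(1-xp^{k-1})$ (with $(x;p)_0=1$), and $(x_1,\dots,x_m;p)_k=(x_1;p)_k\cdots(x_m;p)_k$. The $q$-integer is $[m]=(1-q^m)/(1-q)$ (for any integer $m$, so $[-1]=(1-q^{-1})/(1-q)$). $\Phi_n(q)$ denotes the $n$-th cyclotomic polynomial in $q$. Two rational functions $A$ and $B$ (here in $q$ and $e$) are congruent modulo a polynomial $P(q)$ if $P(q)$ divides the numerator of the reduced form of $A-B$ (the denominators being coprime to $P(q)$). *)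

(* Defs.v *)
From HB Require Import structures.
From mathcomp Require Import all_boot all_order all_algebra all_field.
Set Implicit Arguments.
Unset Strict Implicit.
Unset Printing Implicit Defensive.
Import GRing.Theory.
Local Open Scope ring_scope.

(* True divisibility in R: on {poly R} with R not a field, the library's
   %| is only divisibility up to a scalar factor. *)
Definition divides (R : idomainType) (a b : R) : Prop := exists c, b = c * a.

Definition reduced_form (R : idomainType) (x : {fraction R}) (N D : R) : Prop :=
  [/\ D != 0,
      x = FracField.tofrac N / FracField.tofrac D
    & forall g : R, divides g N -> divides g D -> g \is a GRing.unit].

(* Coprimality of D and P is automatic, as N and D are coprime and P
   divides N. *)
Definition frac_congr (R : idomainType) (P : R) (A B : {fraction R}) : Prop :=
  exists N D : R, reduced_form (A - B) N D /\ divides P N.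

(* Q[q, e], with q as the outer and e as the inner variable. *)
Notation Qqe := {poly {poly rat}}.

Definition q : {fraction Qqe} := FracField.tofrac ('X : Qqe).
Definition e : {fraction Qqe} := FracField.tofrac ('X%:P : Qqe).

Definition Phi (n : nat) : Qqe := map_poly intr 'Phi_n.

Definition qpoch (K : fieldType) (x p : K) (k : nat) : K :=
  \prod_(0 <= j < k) (1 - x * p ^+ j).

Definition qpochs (K : fieldType) (xs : seq K) (p : K) (k : nat) : K :=
  \prod_(x <- xs) qpoch x p k.

Definition qint (m : int) : {fraction Qqe} := (1 - q ^ m) / (1 - q).

(* Main.v *)
Require Import Defs.
From HB Require Import structures.
From mathcomp Require Import all_boot all_order all_algebra all_field.
From mathcomp Require Import ring zify.
From Stdlib Require Import Classical.
Import GRing.Theory.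
Local Open Scope ring_scope.
Set Implicit Arguments.
Unset Strict Implicit.
Unset Printing Implicit Defensive.

(* Put p = q^d, a = q^-1 and replace the two numerator parameters q, q by
   b = q X and c = q / X.  A WZ-type contiguous relation links the sum at (a, b)
   to the sum at (a p^2, b p^2), so the sum vanishes both when b = p^-(2i+1) and
   when a = p^-2i.  After clearing denominators the sum is a polynomial in X.
   Since n = d + 1 + 2di, the first case gives the roots X = q^n and X = q^-n.
   At a primitive n-th root of unity q^-1 agrees with p^-2M', where
   2dM' = (d-1)n + 1, so by the second case all coefficients vanish modulo
   Phi_n(q).  At X = 1 this gives (1 - q^n)(1 - q^-n) times a multiple of
   Phi_n(q). *)

(** At a = q^-1 and b = c = q no parameter is one of the negative powers of p that the descent can
    treat, so a parameter has to be moved. Moving b and c in opposite directions keeps b c = q^2,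
    hence X enters only two pairs of factorials, each of them a polynomial in X up to a power of X.
    Moving a is harmless only modulo Phi_n, but it leaves X free, so that it controls every
    coefficient at once; division by the monic factors X - q^n and X - q^-n then preserves the
    divisibility by Phi_n.

    The upper limit M must be large enough for the boundary term of the telescoped relation to
    vanish in both cases, and small enough for the denominators up to M to stay prime to Phi_n.
    Divisibility by Phi_n is read off at q = z, a primitive n-th root of unity, with e kept as a
    variable; the image of e is transcendental, so denominators containing e cannot vanish there. *)

(** * The contiguous relation and its WZ certificate *)

Section WZ.
Variable F : fieldType.
Implicit Types a b c e p x y : F.

Lemma qpoch0 x p : qpoch x p 0 = 1.
Proof. by rewrite /qpoch big_geq. Qed.

Lemma qpochS x p k : qpoch x p k.+1 = qpoch x p k * (1 - x * p ^+ k).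
Proof. by rewrite /qpoch big_nat_recr. Qed.

Lemma qpoch_shift x p k :
  (1 - x) * qpoch (x * p) p k = qpoch x p k * (1 - x * p ^+ k).
Proof.
rewrite -qpochS /qpoch big_nat_recl // expr0 mulr1; congr (_ * _).
by apply: eq_bigr => i _; rewrite exprS mulrA.
Qed.

Lemma qpoch_neq0 x p k :
  (forall j, (j < k)%N -> x * p ^+ j != 1) -> qpoch x p k != 0.
Proof.
move=> h; rewrite /qpoch big_mkord prodf_seq_neq0; apply/allP=> j _ /=.
by rewrite subr_eq0 eq_sym h.
Qed.

Lemma qpoch_eq0 x p k j : (j < k)%N -> x * p ^+ j = 1 -> qpoch x p k = 0.
Proof.
move=> jk h; apply/eqP; rewrite /qpoch big_mkord prodf_seq_eq0.
by apply/hasP; exists (Ordinal jk); rewrite ?mem_index_enum //= h subrr.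
Qed.

Definition qterm a b c e p k : F :=
  (1 - a * p ^+ (3 * k)) *
  (qpoch a (p ^+ 2) k * qpoch e (p ^+ 2) k * qpoch (a * p / e) (p ^+ 2) k *
   (qpoch b p k * qpoch c p k * qpoch (a * p / (b * c)) p k) * p ^+ k) /
  (qpoch p p k * qpoch e p k * qpoch (a * p / e) p k *
   (qpoch (a * p ^+ 2 / b) (p ^+ 2) k * qpoch (a * p ^+ 2 / c) (p ^+ 2) k *
    qpoch (b * c * p) (p ^+ 2) k)).

(* [wzD] times [qterm] at (a, b) and [wzC] times [qterm] at (a p^2, b p^2) are
   both polynomials in p^k times [wzV]; [wzW] is the resulting WZ certificate. *)
Definition wzV a b c e p k : F :=
  (qpoch a (p ^+ 2) k * qpoch e (p ^+ 2) k * qpoch (a * p / e) (p ^+ 2) k *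
   (qpoch b p k * qpoch c p k * qpoch (a * p / (b * c)) p k) * p ^+ k) /
  (qpoch p p k * qpoch e p k * qpoch (a * p ^+ 3 / e) p k *
   (qpoch (a * p ^+ 2 / b) (p ^+ 2) k * qpoch (a * p ^+ 4 / c) (p ^+ 2) k *
    qpoch (b * c * p ^+ 3) (p ^+ 2) k)).

(** Apart from a factor p, the ratio of consecutive values of [wzV] is [wzA] at y = p^k over [wzB]
    at y = p^(k+1). The certificate has Gosper's form: [wzB] times a Laurent polynomial in y times
    [wzV]. *)
Definition wzB a b c e p y : F :=
  (1 - y) * (1 - a * p ^+ 2 * y / e) * (1 - e * y / p) * (1 - a * y ^+ 2 / b) *
  (1 - a * p ^+ 2 * y ^+ 2 / c) * (1 - b * c * p * y ^+ 2).

Definition wzA a b c e p y : F :=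
  (1 - e * y ^+ 2) * (1 - c * y) * (1 - a * p * y / (b * c)) *
  (1 - a * y ^+ 2) * (1 - a * p * y ^+ 2 / e) * (1 - b * y).

(** This is Gosper's equation: with f(y) = y^-1 - (a b p / e) y, the last bracket is p A(y) f(p y) -
    B(y) f(y), where A and B stand for [wzA] and [wzB]. *)
Lemma wz_poly a b c e p y : b != 0 -> c != 0 -> e != 0 -> p != 0 -> y != 0 ->
  (1 - b * p / e) * (1 - b) *
    ((1 - a * y ^+ 3) * (1 - a * p ^+ 2 * y / e) * (1 - a * p * y / e) *
     (1 - a * p ^+ 2 * y ^+ 2 / c) * (1 - b * c * p * y ^+ 2)) -
  (1 - b * c * p / e) * (1 - a * p ^+ 2 / (c * e)) *
    ((1 - a * p ^+ 2 * y ^+ 3) * (1 - a * y ^+ 2) * (1 - a * p * y ^+ 2 / e) *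
     (1 - b * p * y) * (1 - b * y)) =
  - (b * p / e) * (wzA a b c e p y * (y^-1 - a * b * p / e * p ^+ 2 * y) -
                   wzB a b c e p y * (y^-1 - a * b * p / e * y)).
Proof.
move=> b0 c0 e0 p0 y0; rewrite /wzA /wzB; field.
by rewrite ?b0 ?c0 ?e0 ?p0 ?y0.
Qed.

Lemma qpoch_shift2 x p k :
  (1 - x) * (1 - x * p) * qpoch (x * p ^+ 2) p k =
  qpoch x p k * (1 - x * p ^+ k) * (1 - x * p ^+ k.+1).
Proof.
have := qpoch_shift (x * p) p k; rewrite -mulrA -expr2 => h.
by rewrite -mulrA h mulrA qpoch_shift exprS !mulrA.
Qed.

Lemma neq1_sub x : x != 1 -> 1 - x != 0.
Proof. by move=> h; rewrite subr_eq0 eq_sym. Qed.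

(** Nonvanishing is asked for every j, so that it passes to the shifted parameters and no summation
    range has to be tracked. *)
Record wz_generic a b c e p : Prop := WZGeneric {
  wz_p0 : p != 0;
  wz_b0 : b != 0;
  wz_c0 : c != 0;
  wz_e0 : e != 0;
  wz_p : forall j, p ^+ j.+1 != 1;
  wz_e : forall j, e * p ^+ j != 1;
  wz_ae : forall j, a * p / e * p ^+ j != 1;
  wz_ab : forall j, a * p ^+ 2 / b * (p ^+ 2) ^+ j != 1;
  wz_ac : forall j, a * p ^+ 2 / c * (p ^+ 2) ^+ j != 1;
  wz_bc : forall j, b * c * p * (p ^+ 2) ^+ j != 1 }.

Lemma wz_generic_shift a b c e p : wz_generic a b c e p ->
  wz_generic (a * p ^+ 2) (b * p ^+ 2) c e p.
Proof.
case=> p0 b0 c0 e0 hp he hae hab hac hbc; split=> //.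
- by rewrite mulf_neq0 ?expf_neq0.
- by move=> j; have := hae j.+2; congr (_ != 1); rewrite !exprS; ring.
- move=> j; have := hab j; congr (_ != 1); congr (_ * _).
  by field; rewrite ?b0 ?p0.
- by move=> j; have := hac j.+1; congr (_ != 1); rewrite !exprS; ring.
- by move=> j; have := hbc j.+1; congr (_ != 1); rewrite !exprS; ring.
Qed.

Definition wzC a b e p : F :=
  (1 - a) * (1 - a * p / e) * (1 - b * p) * (1 - b).
Definition wzD a b c e p : F :=
  (1 - a * p / e) * (1 - a * p ^+ 2 / e) * (1 - a * p ^+ 2 / c) *
  (1 - b * c * p).

(** [wzV] joins the numerators of the term at (a, b) to the denominators of the term at (a p^2, b
    p^2). Here only three denominators change, and [wzD] collects their initial factors; [wzC] does
    the same for the three numerators that change under the shift. *)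
Lemma wzV_lhs a b c e p k : wz_generic a b c e p ->
  wzD a b c e p * qterm a b c e p k =
  (1 - a * (p ^+ k) ^+ 3) * (1 - a * p ^+ 2 * p ^+ k / e) *
  (1 - a * p * p ^+ k / e) * (1 - a * p ^+ 2 * (p ^+ k) ^+ 2 / c) *
  (1 - b * c * p * (p ^+ k) ^+ 2) * wzV a b c e p k.
Proof.
move=> g; have [p0 b0 c0 e0 hp he hae hab hac hbc] := g.
have h1 := qpoch_shift2 (a * p / e) p k.
have h2 := qpoch_shift (a * p ^+ 2 / c) (p ^+ 2) k.
have h3 := qpoch_shift (b * c * p) (p ^+ 2) k.
have e1 : a * p / e * p ^+ 2 = a * p ^+ 3 / e by ring.
have e2 : a * p ^+ 2 / c * p ^+ 2 = a * p ^+ 4 / c by ring.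
have e3 : b * c * p * p ^+ 2 = b * c * p ^+ 3 by ring.
rewrite {}e1 in h1; rewrite {}e2 in h2; rewrite {}e3 in h3.
rewrite /wzD /qterm /wzV.
have n1 : qpoch p p k != 0.
  by apply: qpoch_neq0 => j _; rewrite -exprS.
have n2 : qpoch e p k != 0 by apply: qpoch_neq0.
have n3 : qpoch (a * p / e) p k != 0 by apply: qpoch_neq0.
have n4 : qpoch (a * p ^+ 2 / b) (p ^+ 2) k != 0 by apply: qpoch_neq0.
have n5 : qpoch (a * p ^+ 2 / c) (p ^+ 2) k != 0 by apply: qpoch_neq0.
have n6 : qpoch (b * c * p) (p ^+ 2) k != 0 by apply: qpoch_neq0.
have m1 : qpoch (a * p ^+ 3 / e) p k != 0.
  apply: qpoch_neq0 => j _; have := hae j.+2; congr (_ != 1).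
  by rewrite !exprS; ring.
have m2 : qpoch (a * p ^+ 4 / c) (p ^+ 2) k != 0.
  apply: qpoch_neq0 => j _; have := hac j.+1; congr (_ != 1).
  by rewrite !exprS; ring.
have m3 : qpoch (b * c * p ^+ 3) (p ^+ 2) k != 0.
  apply: qpoch_neq0 => j _; have := hbc j.+1; congr (_ != 1).
  by rewrite !exprS; ring.
rewrite mulnC !exprM -!exprM [(2 * k)%N]mulnC !exprM in h1 h2 h3 *.
rewrite [p ^+ k.+1]exprS in h1.
move: (p ^+ k) h1 h2 h3 => y.
have -> : 1 - a * p / e * (p * y) = 1 - a * p ^+ 2 * y / e by ring.
have -> : 1 - a * p / e * y = 1 - a * p * y / e by ring.
have -> : 1 - a * p / e * p = 1 - a * p ^+ 2 / e by ring.
have -> : 1 - a * p ^+ 2 / c * y ^+ 2 = 1 - a * p ^+ 2 * y ^+ 2 / c by ring.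
move=> h1 h2 h3.
move: (qpoch (a * p / e) (p ^+ 2) k) => ne.
move: (qpoch (a * p / (b * c)) p k) (qpoch a (p ^+ 2) k) (qpoch e (p ^+ 2) k) => x1 x2 x3.
move: h1 h2 h3 n1 n2 n3 n4 n5 n6 m1 m2 m3.
move: (qpoch p p k) (qpoch e p k) (qpoch (a * p / e) p k) => r1 r2 r3.
move: (qpoch (a * p ^+ 2 / b) (p ^+ 2) k) (qpoch (a * p ^+ 2 / c) (p ^+ 2) k)
  (qpoch (b * c * p) (p ^+ 2) k) => r4 r5 r6.
move: (qpoch (a * p ^+ 3 / e) p k) (qpoch (a * p ^+ 4 / c) (p ^+ 2) k)
  (qpoch (b * c * p ^+ 3) (p ^+ 2) k) => s1 s2 s3.
move: (1 - a * p / e) (1 - a * p ^+ 2 / e) (1 - a * p * y / e)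
  (1 - a * p ^+ 2 * y / e) => u1 u2 u3 u4.
move: (1 - a * p ^+ 2 / c) (1 - a * p ^+ 2 * y ^+ 2 / c) (1 - b * c * p)
  (1 - b * c * p * y ^+ 2) => u5 u6 u7 u8.
move=> h1 h2 h3 n1 n2 n3 n4 n5 n6 m1 m2 m3.
move: (1 - a * y ^+ 3) (qpoch b p k) (qpoch c p k) => x4 x5 x6.
apply: (mulfI (mulf_neq0 (mulf_neq0 n3 n5) n6)).
apply: (mulfI (mulf_neq0 (mulf_neq0 m1 m2) m3)).
transitivity (x4 * (x2 * x3 * ne * (x5 * x6 * x1) * y) / (r1 * r2 * r4) *
  (u1 * u2 * s1) * (u5 * s2) * (u7 * s3)).
  by field; rewrite ?n1 ?n2 ?n3 ?n4 ?n5 ?n6.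
rewrite h1 h2 h3.
by field; rewrite ?n1 ?n2 ?n3 ?n4 ?m1 ?m2 ?m3.
Qed.

Lemma wzV_rhs a b c e p k : wz_generic a b c e p ->
  wzC a b e p * qterm (a * p ^+ 2) (b * p ^+ 2) c e p k =
  (1 - a * p ^+ 2 * (p ^+ k) ^+ 3) * (1 - a * (p ^+ k) ^+ 2) *
  (1 - a * p * (p ^+ k) ^+ 2 / e) * (1 - b * p * p ^+ k) *
  (1 - b * p ^+ k) * wzV a b c e p k.
Proof.
move=> g; have [p0 b0 c0 e0 hp he hae hab hac hbc] := g.
have h1 := qpoch_shift2 b p k.
have h2 := qpoch_shift a (p ^+ 2) k.
have h3 := qpoch_shift (a * p / e) (p ^+ 2) k.
have e3 : a * p / e * p ^+ 2 = a * p ^+ 3 / e by ring.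
rewrite {}e3 in h3.
rewrite /wzC /qterm /wzV.
have -> : a * p ^+ 2 * p / e = a * p ^+ 3 / e by ring.
have -> : a * p ^+ 2 * p / (b * p ^+ 2 * c) = a * p / (b * c).
  by field; rewrite ?b0 ?c0 ?p0.
have -> : a * p ^+ 2 * p ^+ 2 / (b * p ^+ 2) = a * p ^+ 2 / b.
  by field; rewrite ?b0 ?c0 ?p0.
have -> : a * p ^+ 2 * p ^+ 2 / c = a * p ^+ 4 / c by ring.
have -> : b * p ^+ 2 * c * p = b * c * p ^+ 3 by ring.
rewrite mulnC !exprM -!exprM [(2 * k)%N]mulnC !exprM in h1 h2 h3 *.
rewrite [p ^+ k.+1]exprS in h1.
move: (p ^+ k) h1 h2 h3 => y.
have -> : 1 - b * (p * y) = 1 - b * p * y by ring.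
have -> : 1 - a * p / e * y ^+ 2 = 1 - a * p * y ^+ 2 / e by ring.
move=> h1 h2 h3.
transitivity ((1 - a * p ^+ 2 * y ^+ 3) *
  ((1 - a) * qpoch (a * p ^+ 2) (p ^+ 2) k) *
  ((1 - a * p / e) * qpoch (a * p ^+ 3 / e) (p ^+ 2) k) *
  ((1 - b) * (1 - b * p) * qpoch (b * p ^+ 2) p k) *
  ((qpoch e (p ^+ 2) k * (qpoch c p k * qpoch (a * p / (b * c)) p k) * y) /
  (qpoch p p k * qpoch e p k * qpoch (a * p ^+ 3 / e) p k *
   (qpoch (a * p ^+ 2 / b) (p ^+ 2) k * qpoch (a * p ^+ 4 / c) (p ^+ 2) k *
    qpoch (b * c * p ^+ 3) (p ^+ 2) k)))); first by ring.
by rewrite h1 h2 h3; ring.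
Qed.

Definition wzW a b c e p k : F :=
  wzB a b c e p (p ^+ k) * ((p ^+ k)^-1 - a * b * p / e * p ^+ k) *
  wzV a b c e p k.

Lemma wzW_succ a b c e p k : wz_generic a b c e p ->
  wzW a b c e p k.+1 = wzA a b c e p (p ^+ k) *
    ((p ^+ k)^-1 - a * b * p / e * p ^+ 2 * p ^+ k) * wzV a b c e p k.
Proof.
move=> g; have [p0 b0 c0 e0 hp he hae hab hac hbc] := g.
have n1 : 1 - p * p ^+ k != 0 by rewrite neq1_sub // -exprS.
have n2 : 1 - e * p ^+ k != 0 by rewrite neq1_sub.
have n3 : 1 - a * p ^+ 3 / e * p ^+ k != 0.
  rewrite neq1_sub //; have := hae k.+2; congr (_ != 1).
  by rewrite !exprS; ring.
have n4 : 1 - a * p ^+ 2 / b * (p ^+ 2) ^+ k != 0 by rewrite neq1_sub.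
have n5 : 1 - a * p ^+ 4 / c * (p ^+ 2) ^+ k != 0.
  rewrite neq1_sub //; have := hac k.+1; congr (_ != 1).
  by rewrite !exprS; ring.
have n6 : 1 - b * c * p ^+ 3 * (p ^+ 2) ^+ k != 0.
  rewrite neq1_sub //; have := hbc k.+1; congr (_ != 1).
  by rewrite !exprS; ring.
have y0 : p ^+ k != 0 by rewrite expf_neq0.
rewrite /wzW /wzV !qpochS /wzA exprSr.
rewrite -!exprM [(2 * k)%N]mulnC !exprM in n1 n2 n3 n4 n5 n6 *.
set y := p ^+ k in n1 n2 n3 n4 n5 n6 y0 *.
set d1 := (1 - p * y) in n1 *; set d2 := 1 - e * y in n2 *.
set d3 := 1 - _ * y in n3 *; set d4 := 1 - _ * y ^+ 2 in n4 *.
set d5 := 1 - a * p ^+ 4 / _ * y ^+ 2 in n5 *.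
set d6 := 1 - b * c * p ^+ 3 * y ^+ 2 in n6 *.
have -> : wzB a b c e p (y * p) = d1 * d2 * d3 * d4 * d5 * d6.
  by rewrite /wzB /d1 /d2 /d3 /d4 /d5 /d6; field; rewrite ?p0 ?b0 ?c0 ?e0.
have -> : 1 - a * p / (b * c) * y = 1 - a * p * y / (b * c) by ring.
have -> : 1 - a * p / e * y ^+ 2 = 1 - a * p * y ^+ 2 / e by ring.
have -> : (y * p)^-1 - a * b * p / e * (y * p) =
   p^-1 * (y^-1 - a * b * p / e * p ^+ 2 * y).
  by field; rewrite ?p0 ?e0 ?y0.
move: (y^-1 - a * b * p / e * p ^+ 2 * y) => w.
rewrite !invfM.
move: (qpoch p p k)^-1 (qpoch e p k)^-1 (qpoch _ p k)^-1 => i1 i2 i3.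
move: (qpoch _ _ k)^-1 (qpoch _ _ k)^-1 (qpoch _ _ k)^-1 => i4 i5 i6.
move: (qpoch _ _ k)^-1 => i7.
by field; rewrite ?n1 ?n2 ?n3 ?n4 ?n5 ?n6 ?p0 ?b0 ?c0 ?e0.
Qed.

Lemma wz_sum a b c e p L : wz_generic a b c e p ->
  (1 - b * p / e) * (1 - b) * wzD a b c e p *
    (\sum_(0 <= k < L) qterm a b c e p k) -
  (1 - b * c * p / e) * (1 - a * p ^+ 2 / (c * e)) * wzC a b e p *
    (\sum_(0 <= k < L) qterm (a * p ^+ 2) (b * p ^+ 2) c e p k) =
  - (b * p / e) * wzW a b c e p L.
Proof.
move=> g; have [p0 b0 c0 e0 _ _ _ _ _ _] := g.
(* The factor 1 - y of [wzB] vanishes at y = p^0, so there is no lower boundary term. *)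
have W0 : wzW a b c e p 0 = 0 by rewrite /wzW /wzB expr0 subrr !mul0r.
have <- : \sum_(0 <= k < L) (wzW a b c e p k.+1 - wzW a b c e p k) =
    wzW a b c e p L by rewrite telescope_sumr // W0 subr0.
rewrite !mulr_sumr -sumrB; apply: eq_bigr => k _.
have y0 : p ^+ k != 0 by rewrite expf_neq0.
rewrite wzW_succ // /wzW.
have := wzV_lhs k g; have := wzV_rhs k g.
have := wz_poly a b0 c0 e0 p0 y0.
move: (wzA _ _ _ _ _ _) (wzB _ _ _ _ _ _) (wzC _ _ _ _) (wzD _ _ _ _ _).
move: (qterm (a * p ^+ 2) (b * p ^+ 2) c e p k) (qterm a b c e p k) (wzV _ _ _ _ _ _).
move=> t' t V A B C D h hr hl.
transitivity ((1 - b * p / e) * (1 - b) * (D * t) -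
  (1 - b * c * p / e) * (1 - a * p ^+ 2 / (c * e)) * (C * t')); first by ring.
rewrite hl hr.
move/(congr1 (fun x => x * V)): h => h.
transitivity (- (b * p / e) *
  (A * ((p ^+ k)^-1 - a * b * p / e * p ^+ 2 * p ^+ k) -
   B * ((p ^+ k)^-1 - a * b * p / e * p ^+ k)) * V); last by ring.
by rewrite -h; ring.
Qed.
End WZ.

(** * Descent to vanishing sums *)

Section Vanishing.
Variable F : fieldType.
Implicit Types a b c e p x y : F.

Lemma qpoch_sq_eq0 x p k j :
  (j < k)%N -> x * p ^+ (2 * j) = 1 -> qpoch x (p ^+ 2) k = 0.
Proof. by move=> jk h; apply: (qpoch_eq0 jk); rewrite -exprM. Qed.

Lemma wzD_neq0 a b c e p : wz_generic a b c e p -> wzD a b c e p != 0.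
Proof.
case=> p0 b0 c0 e0 hp he hae hab hac hbc; rewrite /wzD.
have n1 : a * p / e != 1 by have := hae 0%N; rewrite expr0 mulr1.
have n2 : a * p ^+ 2 / e != 1.
  by have := hae 1%N; congr (_ != 1); rewrite expr1; ring.
have n3 : a * p ^+ 2 / c != 1 by have := hac 0%N; rewrite expr0 mulr1.
have n4 : b * c * p != 1 by have := hbc 0%N; rewrite expr0 mulr1.
by rewrite !mulf_neq0 ?neq1_sub.
Qed.

Lemma qsum_eq0_step a b c e p L : wz_generic a b c e p ->
  b != 1 -> b * p != e -> wzW a b c e p L = 0 ->
  wzC a b e p *
    (\sum_(0 <= k < L) qterm (a * p ^+ 2) (b * p ^+ 2) c e p k) = 0 ->
  \sum_(0 <= k < L) qterm a b c e p k = 0.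
Proof.
move=> g b1 be W0 S0; have := wz_sum L g; have e0 := wz_e0 g.
rewrite W0 mulr0 -[X in _ - X]mulrA S0 mulr0 subr0 => /eqP.
move: (wzD _ _ _ _ _) (wzD_neq0 g) => D D0.
rewrite !mulf_eq0 (negPf D0) (negPf (neq1_sub b1)) orbF orbF.
have /negPf -> /= : 1 - b * p / e != 0.
  apply: neq1_sub; apply: contraNneq be => h.
  by rewrite -(divfK e0 (b * p)) h mul1r.
by move/eqP.
Qed.

(** The boundary term contains (b; p)_L = 0, and each shift of b lowers i by one until b p = 1
    annihilates [wzC]. The odd exponent matters: an even one would lead to b = 1, where the
    coefficient 1 - b of the sum itself vanishes. *)
Lemma qsum_b_terminating i L a b c e p : wz_generic a b c e p ->
  b * p ^+ (2 * i).+1 = 1 -> ((2 * i).+1 < L)%N ->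
  \sum_(0 <= k < L) qterm a b c e p k = 0.
Proof.
elim: i a b => [|i IH] a b g hb iL; have [p0 b0 c0 e0 hp he hae hab hac hbc] := g.
all: apply: qsum_eq0_step => //.
(* If b = 1, a positive power of p would be 1; if b p = e, then e p^(2i) would be 1. *)
1,5: by apply: contra_neq (hp _) => b1; move: hb; rewrite b1 mul1r; apply.
1,4: by move: hb; rewrite exprS mulrA => hb; apply: contra_neq (he _) => <-; exact: hb.
1,3: by rewrite /wzW /wzV (qpoch_eq0 iL hb) ?(mulr0, mul0r).
- by rewrite /wzC; move: hb; rewrite muln0 expr1 => ->; rewrite subrr !(mulr0, mul0r).
- rewrite (IH (a * p ^+ 2) (b * p ^+ 2)) ?mulr0 //.
  + exact: wz_generic_shift.
  + by rewrite -mulrA -exprD addnS -mulnS.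
  + by apply: leq_trans iL; rewrite !ltnS leq_mul2l leqnSn orbT.
Qed.

(** The boundary term contains (a; p^2)_L = 0, and the descent ends at a = 1, where the factor 1 - a
    of [wzC] vanishes. Termination in a does not control b, so the divisors 1 - b and 1 - b p / e
    are assumed nonzero at every stage. *)
Lemma qsum_a_terminating i L a b c e p : wz_generic a b c e p ->
  a * p ^+ (2 * i) = 1 -> (i < L)%N ->
  (forall j, b * p ^+ j != 1) -> (forall j, b * p ^+ j != e) ->
  \sum_(0 <= k < L) qterm a b c e p k = 0.
Proof.
elim: i a b => [|i IH] a b g ha iL b1 be; have [p0 b0 c0 e0 hp he hae hab hac hbc] := g.
all: apply: qsum_eq0_step => //.
1,5: by have := b1 0%N; rewrite expr0 mulr1.
1,4: by have := be 1%N; rewrite expr1.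
1,3: by rewrite /wzW /wzV (qpoch_sq_eq0 iL ha) ?(mulr0, mul0r).
- by rewrite /wzC; move: ha; rewrite muln0 expr0 mulr1 => ->; rewrite subrr !mul0r.
- rewrite (IH (a * p ^+ 2) (b * p ^+ 2)) ?mulr0 //.
  + exact: wz_generic_shift.
  + by rewrite -mulrA -exprD -mulnS.
  + exact: ltnW.
  + by move=> j; rewrite -mulrA -exprD.
  + by move=> j; rewrite -mulrA -exprD.
Qed.

Lemma qtermC a b c e p k : qterm a b c e p k = qterm a c b e p k.
Proof.
rewrite /qterm [c * b]mulrC [qpoch c p k * qpoch b p k]mulrC.
by rewrite [qpoch (a * p ^+ 2 / c) _ _ * _]mulrC.
Qed.
End Vanishing.

(** * The sum as a polynomial in X *)

Section QPoly.
Variable F : fieldType.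
Implicit Types a b c e p s u x : F.

(** At x this is x (1 - u x)(1 - u / x), a pair of factors exchanged by X -> 1/X and cleared of its
    denominator. *)
Definition lin2 u : {poly F} := ('X - u%:P) * (1 - u *: 'X).

Lemma horner_lin2 u x : (lin2 u).[x] = (x - u) * (1 - u * x).
Proof.
by rewrite /lin2 hornerM hornerXsubC hornerD hornerN hornerZ hornerX -polyC1 hornerC.
Qed.

Lemma horner_lin2_prod u p x k : x != 0 ->
  (\prod_(0 <= j < k) lin2 (u * p ^+ j)).[x] =
  x ^+ k * (qpoch (u * x) p k * qpoch (u / x) p k).
Proof.
move=> x0; elim: k => [|k IH].
  by rewrite big_geq // hornerE !qpoch0 expr0 !mulr1.
rewrite big_nat_recr // hornerM {}IH !qpochS exprS horner_lin2.
by field.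
Qed.

(** The part of the term that is free of X, with b c = s^2. *)
Definition qcoef a s e p k : F :=
  (1 - a * p ^+ (3 * k)) *
  (qpoch a (p ^+ 2) k * qpoch e (p ^+ 2) k * qpoch (a * p / e) (p ^+ 2) k *
   qpoch (a * p / s ^+ 2) p k * p ^+ k) /
  (qpoch p p k * qpoch e p k * qpoch (a * p / e) p k *
   qpoch (s ^+ 2 * p) (p ^+ 2) k).

Lemma qcoef_den_neq0 a s e p M k : (k <= M)%N ->
  (forall j, (j < M)%N -> p ^+ j.+1 != 1) ->
  (forall j, e * p ^+ j != 1) ->
  (forall j, a * p / e * p ^+ j != 1) ->
  (forall j, (j < M)%N -> s ^+ 2 * p * (p ^+ 2) ^+ j != 1) ->
  qpoch p p k * qpoch e p k * qpoch (a * p / e) p k *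
   qpoch (s ^+ 2 * p) (p ^+ 2) k != 0.
Proof.
move=> kM hp he hae hs; rewrite !mulf_neq0 //; apply: qpoch_neq0 => j jk //.
  by rewrite -exprS hp // (leq_trans jk).
by rewrite hs // (leq_trans jk).
Qed.

(* The sum with [b = s X] and [c = s / X], times its common denominator in X;
   the powers of X from the numerators and denominators cancel. *)
Definition qsum_poly a s e p M : {poly F} :=
  \sum_(0 <= k < M.+1) qcoef a s e p k *:
    (\prod_(0 <= j < k) lin2 (s * p ^+ j) *
     \prod_(k <= j < M) lin2 (a * p ^+ 2 / s * (p ^+ 2) ^+ j)).

Lemma horner_qsum_poly a s e p M x : s != 0 -> x != 0 ->
  wz_generic a (s * x) (s / x) e p ->
  (qsum_poly a s e p M).[x] =
  (\prod_(0 <= j < M) lin2 (a * p ^+ 2 / s * (p ^+ 2) ^+ j)).[x] *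
  \sum_(0 <= k < M.+1) qterm a (s * x) (s / x) e p k.
Proof.
move=> s0 x0 g; rewrite horner_sum mulr_sumr; apply: eq_big_nat => k /=.
rewrite ltnS => kM.
(* The common denominator is split at k: its factors below k cancel the denominator of the k-th
   term, the others survive. *)
rewrite hornerZ hornerM (@big_cat_nat _ _ _ k 0 M) //= hornerM !horner_lin2_prod //.
rewrite /qcoef /qterm; case: g => _ _ _ e0 hp he hae hab hac hbc.
have -> : s * x * (s / x) = s ^+ 2 by field.
have n1 : qpoch (a * p ^+ 2 / (s * x)) (p ^+ 2) k != 0 by apply: qpoch_neq0.
have n2 : qpoch (a * p ^+ 2 / (s / x)) (p ^+ 2) k != 0 by apply: qpoch_neq0.
have e1 : a * p ^+ 2 / s * x = a * p ^+ 2 / (s / x) by field; rewrite ?s0 ?x0.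
have e2 : a * p ^+ 2 / s / x = a * p ^+ 2 / (s * x) by field; rewrite ?s0 ?x0.
rewrite e1 e2; move: n1 n2.
move: (qpoch (_ / (s * x)) _ _) (qpoch (_ / (s / x)) _ _) => r1 r2 n1 n2.
move: (\prod_(_ <= _ < _) _).[x] => z.
rewrite !invfM.
move: (qpoch p p k)^-1 (qpoch e p k)^-1 (qpoch (a * p / e) p k)^-1 => i1 i2 i3.
move: (qpoch (s^+2 * p) (p ^+ 2) k)^-1 => i4.
move: (1 - a * _) (qpoch _ _ _) (qpoch _ _ _) (qpoch _ _ _) => x1 x2 x3 x4.
move: (qpoch _ _ _) (qpoch _ _ _) (qpoch _ _ _) => x5 x6 x7.
by field; rewrite n1 n2.
Qed.
End QPoly.

(** * Residues of fractions under an evaluation *)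

Section Specialization.
Variables (R S : idomainType) (ev : {rmorphism R -> S}).
Local Notation tofrac := (@FracField.tofrac _).
Implicit Types (x y : {fraction R}) (v w : {fraction S}).

(** That is, x lies in the localization of R at the kernel of [ev] and has residue v. A relation
    expresses membership and value together. *)
Definition specializes x v : Prop :=
  exists N D : R, [/\ ev D != 0, x = tofrac N / tofrac D
    & v = tofrac (ev N) / tofrac (ev D)].

Lemma ev_neq0 (D : R) : ev D != 0 -> D != 0.
Proof. by apply: contra_neq => ->; rewrite rmorph0. Qed.

Lemma specializes_uniq x v w : specializes x v -> specializes x w -> v = w.
Proof.
case=> N [D [D0 -> ->]] [N' [D' [D0' /eqP]]].
have tD := ev_neq0 D0; have tD' := ev_neq0 D0'.
rewrite eqr_div ?tofrac_eq0 // -!tofracM tofrac_eq => /eqP h ->.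
apply/eqP; rewrite eqr_div ?tofrac_eq0 // -!tofracM tofrac_eq.
by rewrite -!rmorphM h.
Qed.

Lemma specializes_tofrac N : specializes (tofrac N) (tofrac (ev N)).
Proof. by exists N, 1; rewrite rmorph1 oner_neq0 !tofrac1 !divr1. Qed.

Lemma specializes1 : specializes 1 1.
Proof. by have := specializes_tofrac 1; rewrite !rmorph1. Qed.

Lemma specializes0 : specializes 0 0.
Proof. by have := specializes_tofrac 0; rewrite !rmorph0. Qed.

Lemma specializesD x y v w : specializes x v -> specializes y w ->
  specializes (x + y) (v + w).
Proof.
case=> N [D [D0 -> ->]] [N' [D' [D0' -> ->]]].
have tD := ev_neq0 D0; have tD' := ev_neq0 D0'.
exists (N * D' + N' * D), (D * D'); rewrite rmorphM mulf_neq0 //; split=> //.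
  by rewrite addf_div ?tofrac_eq0 // tofracD !tofracM.
by rewrite addf_div ?tofrac_eq0 // rmorphD !rmorphM tofracD !tofracM.
Qed.

Lemma specializesM x y v w : specializes x v -> specializes y w ->
  specializes (x * y) (v * w).
Proof.
case=> N [D [D0 -> ->]] [N' [D' [D0' -> ->]]].
exists (N * N'), (D * D'); rewrite rmorphM mulf_neq0 //; split=> //.
  by rewrite mulf_div !tofracM.
by rewrite mulf_div rmorphM !tofracM.
Qed.

Lemma specializesN x v : specializes x v -> specializes (- x) (- v).
Proof.
case=> N [D [D0 -> ->]]; exists (- N), D; split=> //.
  by rewrite tofracN mulNr.
by rewrite rmorphN tofracN mulNr.
Qed.

Lemma specializesB x y v w : specializes x v -> specializes y w ->
  specializes (x - y) (v - w).
Proof. by move=> hx /specializesN; apply: specializesD. Qed.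

Lemma specializesV x v : v != 0 -> specializes x v -> specializes x^-1 v^-1.
Proof.
move=> v0 [N [D [D0 -> vE]]]; move: v0; rewrite vE mulf_eq0 negb_or.
by case/andP; rewrite tofrac_eq0 => N0 _; exists D, N; split=> //; rewrite invf_div.
Qed.

Lemma specializes_div x y v w : w != 0 -> specializes x v ->
  specializes y w -> specializes (x / y) (v / w).
Proof. by move=> w0 hx /(specializesV w0); apply: specializesM. Qed.

Lemma specializesX x v k : specializes x v -> specializes (x ^+ k) (v ^+ k).
Proof.
move=> h; elim: k => [|k IH]; first by rewrite !expr0; apply: specializes1.
by rewrite !exprS; apply: specializesM.
Qed.

Lemma specializes_sum (I : Type) (r : seq I) (P : pred I) f g :
  (forall i, P i -> specializes (f i) (g i)) ->
  specializes (\sum_(i <- r | P i) f i) (\sum_(i <- r | P i) g i).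
Proof.
by move=> h; elim/big_rec2: _ => [|i v x Pi];
  [apply: specializes0|apply: specializesD (h _ Pi)].
Qed.

Lemma specializes_qpoch x v y w k : specializes x v -> specializes y w ->
  specializes (qpoch x y k) (qpoch v w k).
Proof.
move=> hx hy; elim: k => [|k IH]; first by rewrite !qpoch0; apply: specializes1.
rewrite !qpochS; apply: specializesM => //; apply: specializesB.
  exact: specializes1.
by apply: specializesM => //; apply: specializesX.
Qed.

Definition pspecializes (P : {poly {fraction R}}) (Q : {poly {fraction S}}) :=
  forall i, specializes P`_i Q`_i.

Lemma pspecializesC x v : specializes x v -> pspecializes x%:P v%:P.
Proof. by move=> h i; rewrite !coefC; case: eqP => // _; apply: specializes0. Qed.

Lemma pspecializesX : pspecializes 'X 'X.
Proof.
move=> i; rewrite !coefX; case: eqP => _; [exact: specializes1|exact: specializes0].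
Qed.

Lemma pspecializesB P P' Q Q' : pspecializes P Q -> pspecializes P' Q' ->
  pspecializes (P - P') (Q - Q').
Proof. by move=> h h' i; rewrite !coefB; apply: specializesB. Qed.

Lemma pspecializesM P P' Q Q' : pspecializes P Q -> pspecializes P' Q' ->
  pspecializes (P * P') (Q * Q').
Proof.
by move=> h h' i; rewrite !coefM; apply: specializes_sum => j _; apply: specializesM.
Qed.

Lemma pspecializesZ x v P Q : specializes x v -> pspecializes P Q ->
  pspecializes (x *: P) (v *: Q).
Proof. by move=> h h' i; rewrite !coefZ; apply: specializesM. Qed.

Lemma pspecializes_prod m n f g :
  (forall i, pspecializes (f i) (g i)) ->
  pspecializes (\prod_(m <= i < n) f i) (\prod_(m <= i < n) g i).
Proof.
move=> h; elim/big_rec2: _ => [|i v x _]; last exact: pspecializesM.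
exact: pspecializesC specializes1.
Qed.

Lemma pspecializes_lin2 x v : specializes x v ->
  pspecializes (lin2 x) (lin2 v).
Proof.
move=> h; apply: pspecializesM; apply: pspecializesB.
- exact: pspecializesX.
- exact: pspecializesC.
- exact: pspecializesC specializes1.
- exact: pspecializesZ pspecializesX.
Qed.

(** Only the denominators of [qcoef] have to survive the reduction; those involving X have been
    cleared. *)
Lemma pspecializes_qsum_poly a a' s s' e e' p p' M :
  specializes a a' -> specializes s s' -> specializes e e' ->
  specializes p p' -> s' != 0 -> e' != 0 ->
  (forall j, (j < M)%N -> p' ^+ j.+1 != 1) ->
  (forall j, e' * p' ^+ j != 1) ->
  (forall j, a' * p' / e' * p' ^+ j != 1) ->
  (forall j, (j < M)%N -> s' ^+ 2 * p' * (p' ^+ 2) ^+ j != 1) ->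
  pspecializes (qsum_poly a s e p M) (qsum_poly a' s' e' p' M).
Proof.
move=> ha hs he hp s0 e0 np ne nae ns i; rewrite !coef_sum.
rewrite !big_mkord; apply: specializes_sum => k _; rewrite !coefZ.
have kM : (k <= M)%N by rewrite -ltnS.
apply: specializesM; last first.
  apply: pspecializesM; apply: pspecializes_prod => j; apply: pspecializes_lin2.
    by apply: specializesM => //; apply: specializesX.
  apply: specializesM; last by do 2!apply: specializesX.
  by apply: specializes_div => //; apply: specializesM => //; apply: specializesX.
have hp2 := specializesX 2 hp.
have hap := specializesM ha hp.
have hape := specializes_div e0 hap he.
apply: specializes_div.
- exact: (qcoef_den_neq0 kM np ne nae ns).
2: { apply: specializesM; last first.
    by apply: specializes_qpoch => //; apply: specializesM => //; apply: specializesX.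
  apply: specializesM; last exact: specializes_qpoch.
  by apply: specializesM; apply: specializes_qpoch. }
apply: specializesM.
  apply: specializesB; first exact: specializes1.
  by apply: specializesM => //; apply: specializesX.
apply: specializesM; last exact: specializesX.
apply: specializesM; last first.
  apply: specializes_qpoch => //; apply: specializes_div => //; rewrite ?expf_neq0 //.
  exact: specializesX.
apply: specializesM; last exact: specializes_qpoch.
by apply: specializesM; apply: specializes_qpoch.
Qed.

(** Synthetic division: each coefficient of Q is one of P plus x times the next one of Q, so residue
    0 spreads downwards from the top degree. The divisor is monic, so no denominator arises. *)
Lemma pspecializes0_root (P Q : {poly {fraction R}}) x v :
  specializes x v -> P = Q * ('X - x%:P) -> pspecializes P 0 ->
  pspecializes Q 0.
Proof.
move=> hx PE hP.
have step i : specializes Q`_i.+1 0 -> specializes Q`_i 0.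
  move=> h; have -> : Q`_i = P`_i.+1 + x * Q`_i.+1.
    by rewrite PE mulrBr coefB coefMX coefMC /= mulrC addrNK.
  rewrite -[X in specializes _ X](addr0 0) -[X in specializes _ (_ + X)](mulr0 v).
  by apply: specializesD; [have := hP i.+1; rewrite coef0|apply: specializesM].
move=> i; rewrite coef0.
have top m : (size Q <= m)%N -> specializes Q`_m 0.
  by move=> /(nth_default 0) ->; apply: specializes0.
case: (leqP (size Q) i) => [|/ltnW iQ]; first exact: top.
rewrite -(subKn iQ); elim: (size Q - i)%N => [|m IH].
  by rewrite subn0; apply: top.
case: (ltnP m (size Q)) => [mQ|]; last first.
  by rewrite -subn_eq0 => /eqP h; rewrite subnS h /=; rewrite h in IH.
by apply: step; rewrite subnSK.
Qed.

Lemma specializes_horner P Q x v :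
  pspecializes P Q -> specializes x v -> specializes P.[x] Q.[v].
Proof.
move=> h hx.
rewrite (@horner_coef_wide _ (maxn (size P) (size Q))) ?leq_maxl //.
rewrite (@horner_coef_wide _ (maxn (size P) (size Q)) Q) ?leq_maxr //.
by apply: specializes_sum => i _; apply: specializesM (specializesX _ hx).
Qed.
End Specialization.

(** * Genericity in terms of exponents of q *)

Lemma wz_generic_exp (F : fieldType) (Q x f : F) (alpha beta gamma : int) (d : nat) :
  (0 < d)%N -> Q != 0 -> f != 0 -> x != 0 ->
  (forall m : int, m <> 0 -> Q ^ m != 1) -> (forall m : int, Q ^ m != f) ->
  (forall j : nat, Q ^ (- (alpha + 2 * d%:Z - beta + 2 * d%:Z * j%:Z)) * x != 1) ->
  (forall j : nat, Q ^ (alpha + 2 * d%:Z - gamma + 2 * d%:Z * j%:Z) * x != 1) ->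
  (forall j : nat, beta + gamma + d%:Z + 2 * d%:Z * j%:Z <> 0) ->
  wz_generic (Q ^ alpha) (Q ^ beta * x) (Q ^ gamma / x) f (Q ^ d%:Z).
Proof.
move=> d0 Q0 f0 x0 hq hf hb hc hbc.
have qn m : Q ^ m != 0 by rewrite expfz_neq0.
have qD m m' : Q ^ (m + m') = Q ^ m * Q ^ m' by rewrite expfzDr.
have qX m k : (Q ^ m) ^+ k = Q ^ (m * k%:Z) by rewrite exprnP exprz_exp.
split => //.
- exact: mulf_neq0.
- by apply: mulf_neq0 => //; rewrite invr_eq0.
- by move=> j; rewrite qX; apply: hq; apply/eqP; rewrite mulf_neq0 // -lt0n.
- move=> j; rewrite qX; apply: contraNneq (hf (- (d%:Z * j%:Z))) => h.
  by rewrite -invr_expz -[X in X == _](mul1r) -h mulfK.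
- move=> j; rewrite qX; apply: contraNneq (hf (alpha + d%:Z + d%:Z * j%:Z)) => h.
  by rewrite -[f]mul1r -h !qD; apply/eqP; field.
(* The parameter a p^2 / b carries 1/x; after inversion x is a factor, as it is for a p^2 / c. *)
- move=> j; rewrite -invr_eq1; have := hb j; congr (_ != 1).
  rewrite -invr_expz !qX [2 * _]mulrC !qD -[Q ^ (- _)]invr_expz; field.
  by rewrite x0 !qn.
- move=> j; have := hc j; congr (_ != 1).
  rewrite !qX [2 * _]mulrC !qD -[Q ^ (- _)]invr_expz; field.
  by rewrite x0 qn.
- move=> j; have := hq _ (hbc j); congr (_ != 1).
  by rewrite !qX [2 * _]mulrC !qD; field.
Qed.

Lemma exprz_natr_neq1 (F : fieldType) (Q : F) (m : int) (x : nat) : Q != 0 ->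
  (forall (m : int) c, Q ^ m = c%:R -> m = 0) ->
  (forall c, c%:R = 1 :> F -> c = 1%N) ->
  (x = 1%N -> m <> 0) -> Q ^ m * x%:R != 1.
Proof.
move=> Q0 hQ hF h; apply/eqP=> h1.
have /hQ m0 : Q ^ (- m) = x%:R.
  by apply: (mulfI (expfz_neq0 m Q0)); rewrite h1 -expfzDr // subrr expr0z.
have m0' : m = 0 by rewrite -[m]opprK m0 oppr0.
by move: h1; rewrite m0' expr0z mul1r => /hF x1; case: (h x1).
Qed.

Section FractionFieldFacts.

Local Notation K := {fraction Qqe}.
Local Notation tofrac := (@FracField.tofrac _).

Lemma q_neq0 : q != 0.
Proof. by rewrite tofrac_eq0 polyX_eq0. Qed.

Lemma natr_Qqe (c : nat) : c%:R = c%:R%:P%:P :> Qqe.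
Proof. by rewrite !rmorph_nat. Qed.

Lemma qX_natr_neq k c : 'X^(k.+1) != c%:R :> Qqe.
Proof.
apply/eqP=> /(congr1 (fun f : Qqe => f`_k.+1)).
by rewrite natr_Qqe coefXn eqxx coefC => /eqP; rewrite oner_eq0.
Qed.

Lemma qz_natr (m : int) c : q ^ m = c%:R -> m = 0.
Proof.
case: m => [[|k]|k] // h.
  have /eqP := h; rewrite -[c%:R](rmorph_nat tofrac) -[q ^ _](rmorphXn tofrac) /=.
  by rewrite tofrac_eq (negPf (qX_natr_neq _ _)).
have : 1 = c%:R * q ^+ k.+1 by rewrite -h NegzE -exprnN mulVf // expf_neq0 // q_neq0.
rewrite -[c%:R](rmorph_nat tofrac) -(rmorphXn tofrac) -(rmorphM tofrac).
rewrite -(rmorph1 tofrac) => /eqP; rewrite tofrac_eq => /eqP.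
move/(congr1 (fun f : Qqe => f`_0)).
by rewrite coefMXn coef1 /= => /eqP; rewrite oner_eq0.
Qed.

Lemma natrK_eq1 c : (c%:R == 1 :> K) = (c == 1%N).
Proof.
rewrite -[c%:R](rmorph_nat tofrac) -(rmorph1 tofrac) tofrac_eq natr_Qqe.
by rewrite -polyC1 -polyC1 !(inj_eq (@polyC_inj _)) Num.Theory.pnatr_eq1.
Qed.

Lemma natrK_eq0 c : (c%:R == 0 :> K) = (c == 0%N).
Proof.
by rewrite -[c%:R](rmorph_nat tofrac) tofrac_eq0 natr_Qqe !polyC_eq0 Num.Theory.pnatr_eq0.
Qed.

Lemma qz_natr_neq_e (m : int) c : (0 < c)%N -> q ^ m * c%:R != e.
Proof.
move=> c0; apply/eqP; case: m => k.
  rewrite -[c%:R](rmorph_nat tofrac) -[q ^ _](rmorphXn tofrac) -(rmorphM tofrac).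
  move/eqP; rewrite tofrac_eq => /eqP /(congr1 (fun f : Qqe => f`_0)).
  rewrite mulrC coefMXn natr_Qqe !coefC /=; case: k => [|k] /= /esym /eqP.
    rewrite /= => /eqP /(congr1 (fun f : {poly rat} => f`_1)).
    by rewrite coefX coefC.
  by rewrite polyX_eq0.
rewrite NegzE -exprnN => h.
have : c%:R = e * q ^+ k.+1.
  by rewrite -h mulrAC mulVf ?mul1r // expf_neq0 // q_neq0.
rewrite -[c%:R](rmorph_nat tofrac) -(rmorphXn tofrac) -(rmorphM tofrac).
move/eqP; rewrite tofrac_eq => /eqP /(congr1 (fun f : Qqe => f`_0)).
rewrite coefMXn natr_Qqe !coefC /= => /eqP.
by rewrite polyC_eq0 Num.Theory.pnatr_eq0 eqn0Ngt c0.
Qed.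

Lemma e_neq0 : e != 0.
Proof. by rewrite tofrac_eq0 polyC_eq0 polyX_eq0. Qed.

Lemma qzD (m m' : int) : q ^ (m + m') = q ^ m * q ^ m'.
Proof. exact: expfzDr q_neq0. Qed.

Lemma qzN (m : int) : q ^ (- m) = (q ^ m)^-1.
Proof. by rewrite -invr_expz. Qed.

Lemma qz_natr_eq1 (m : int) (x : nat) :
  (x = 1%N -> m <> 0) -> q ^ m * x%:R != 1.
Proof.
apply: exprz_natr_neq1; [exact: q_neq0 | exact: qz_natr |].
by move=> c /eqP; rewrite natrK_eq1 => /eqP.
Qed.

(** For x >= 2 no power of q times x equals 1, so the conditions on b and c concern x = 1 alone; in
    b c the factor x cancels. *)
Lemma wz_generic_q (alpha beta gamma : int) (d x : nat) : (0 < d)%N -> (0 < x)%N ->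
  (forall j : nat, x = 1%N -> alpha + 2 * d%:Z - beta + 2 * d%:Z * j%:Z <> 0) ->
  (forall j : nat, x = 1%N -> alpha + 2 * d%:Z - gamma + 2 * d%:Z * j%:Z <> 0) ->
  (forall j : nat, beta + gamma + d%:Z + 2 * d%:Z * j%:Z <> 0) ->
  wz_generic (q ^ alpha) (q ^ beta * x%:R) (q ^ gamma / x%:R) e (q ^ d%:Z).
Proof.
move=> d0 x0 hb hc hbc; apply: wz_generic_exp => //.
- exact: q_neq0.
- exact: e_neq0.
- by rewrite natrK_eq0 -lt0n.
- by move=> m m0; have := @qz_natr_eq1 m 1 (fun _ => m0); rewrite mulr1.
- by move=> m; have := qz_natr_neq_e m (ltn0Sn 0); rewrite mulr1.
- move=> j; apply: qz_natr_eq1 => x1 /eqP; rewrite oppr_eq0 => /eqP.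
  exact: hb.
- by move=> j; apply: qz_natr_eq1 => x1; apply: hc.
Qed.
End FractionFieldFacts.

(** * From residue 0 to a divisible reduced numerator *)

Section ReducedForm.
Variables (R S : idomainType) (ev : {rmorphism R -> S}) (P : R).
Local Notation tofrac := (@FracField.tofrac _).
Hypothesis P0 : P != 0.
Hypothesis evP : ev P = 0.
Hypothesis ker_ev : forall f, ev f = 0 -> divides P f.
Variable m : R -> nat.
Hypothesis m_lt : forall c g, c * g != 0 -> g \isn't a GRing.unit ->
  (m c < m (c * g)%R)%N.

(** The kernel of [ev] is a prime ideal generated by P and g lies outside it, so the powers of P are
    moved into c one at a time. *)
Lemma divides_expl k N c g : ev g != 0 -> P ^+ k * N = c * g ->
  divides (P ^+ k) c.
Proof.
move=> g0; elim: k N c => [|k IH] N c h; first by exists c; rewrite expr0 mulr1.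
have /eqP : ev c * ev g = 0 by rewrite -rmorphM -h rmorphM rmorphXn evP exprS !mul0r.
rewrite mulf_eq0 (negPf g0) orbF => /eqP /ker_ev [c' cE].
have [|c'' c'E] := IH N c'; last by exists c''; rewrite cE c'E exprSr mulrA.
by apply: (mulIf P0); rewrite mulrAC -exprSr h cE mulrAC.
Qed.

(** Common factors are cancelled while the measure of the denominator falls. A common factor divides
    D, hence is not in the kernel of [ev], and its removal costs the numerator no power of P. *)
Lemma reduced_form_exists j N D : ev D != 0 ->
  exists N' D', reduced_form (tofrac (P ^+ j * N) / tofrac D) N' D' /\
    divides (P ^+ j) N'.
Proof.
have [k] := ubnP (m D); elim: k N D => // k IH N D mD D0.
have tD := ev_neq0 D0.
case: (classic (forall g, divides g (P ^+ j * N) -> divides g D ->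
  g \is a GRing.unit)) => [h|].
  exists (P ^+ j * N), D; split; first by split.
  by exists N; rewrite mulrC.
move=> h; have [g hg] := not_all_ex_not _ _ h.
have [[c1 h1] hg'] := imply_to_and _ _ hg.
have [[c2 h2] /negP gu] := imply_to_and _ _ hg'.
have /andP[ec2 eg] : (ev c2 != 0) && (ev g != 0).
  by rewrite -negb_or -mulf_eq0 -rmorphM -h2.
have [N1 cE] := divides_expl eg h1.
have cg : tofrac (P ^+ j * N) / tofrac D = tofrac (P ^+ j * N1) / tofrac c2.
  apply/eqP; rewrite eqr_div ?tofrac_eq0 ?(ev_neq0 ec2) //.
  by rewrite -!tofracM tofrac_eq h1 h2 cE [P ^+ j * _]mulrC mulrA mulrAC.
rewrite cg; apply: IH => //.
have := m_lt (c := c2) (g := g); rewrite -h2 => /(_ tD gu) lt.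
exact: leq_trans lt mD.
Qed.

(** Residue 0 supplies one factor P beyond the j explicit ones. *)
Lemma frac_congr_specializes0 j y :
  specializes ev y 0 -> frac_congr (P ^+ j.+1) (tofrac P ^+ j * y) 0.
Proof.
case=> N [D [D0 -> /esym /eqP]].
rewrite mulf_eq0 invr_eq0 !tofrac_eq0 (negPf D0) orbF => /eqP /ker_ev [N1 ->].
have [N' [D' [red dv]]] := reduced_form_exists j.+1 N1 D0.
exists N', D'; split=> //; rewrite subr0.
move: red; rewrite mulrA exprSr -mulrA [P * _]mulrC tofracM.
by rewrite (rmorphXn tofrac).
Qed.
End ReducedForm.

(** Up to a constant, the degree in q plus the degree in e of the leading coefficient. Both are
    additive, and a nonzero polynomial with both zero is a rational constant, hence a unit. *)
Definition Qqe_measure (f : Qqe) : nat := (size f + size (lead_coef f))%N.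

Lemma Qqe_measure_lt (c g : Qqe) : c * g != 0 -> g \isn't a GRing.unit ->
  (Qqe_measure c < Qqe_measure (c * g)%R)%N.
Proof.
rewrite mulf_eq0 negb_or => /andP[c0 g0] gu.
have lc0 : lead_coef c != 0 by rewrite lead_coef_eq0.
have lg0 : lead_coef g != 0 by rewrite lead_coef_eq0.
rewrite /Qqe_measure lead_coefM !size_mul //.
have : (1 < size g)%N || (1 < size (lead_coef g))%N.
  apply: contraR gu; rewrite negb_or -!leqNgt => /andP[s1 s2].
  have sg : size g == 1%N by rewrite eqn_leq s1 lt0n size_poly_eq0.
  rewrite poly_unitE sg poly_unitE /= unitfE.
  have gE : g`_0 = lead_coef g by rewrite lead_coefE (eqP sg).
  have slg : size (lead_coef g) == 1%N by rewrite eqn_leq s2 lt0n size_poly_eq0.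
  rewrite gE slg /=.
  by move: lg0; rewrite -lead_coef_eq0 lead_coefE (eqP slg).
move: c0 g0 lc0 lg0; rewrite -!size_poly_gt0.
move: (size c) (size g) (size (lead_coef c)) (size (lead_coef g)).
lia.
Qed.

(** * Evaluation of q at a primitive n-th root of unity *)

Section Evaluation.
Variable z : algC.

Local Notation lift := (map_poly (map_poly (ratr : rat -> algC))).

Definition qeval : Qqe -> {poly algC} := horner_eval z%:P \o lift.

HB.instance Definition _ := GRing.RMorphism.copy qeval (horner_eval z%:P \o lift).

Lemma qevalX : qeval 'X = z%:P.
Proof. by rewrite /qeval /= map_polyX horner_evalE hornerX. Qed.

Lemma qevalE : qeval 'X%:P = 'X.
Proof. by rewrite /qeval /= map_polyC horner_evalE hornerC /= map_polyX. Qed.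

Lemma coef_qeval f i :
  (qeval f)`_i = (map_poly ratr (\poly_(j < size f) (f`_j)`_i)).[z].
Proof.
rewrite /qeval /= horner_evalE.
rewrite (@horner_coef_wide _ (size f)) ?size_poly // coef_sum.
rewrite [in RHS](@horner_coef_wide _ (size f)); last first.
  by apply: leq_trans (size_poly _ _) _; apply: size_poly.
apply: eq_bigr => j _.
by rewrite -polyC_exp coefMC !coef_map /= coef_poly ltn_ord.
Qed.

Variable n : nat.
Hypothesis zn : n.-primitive_root z.

Lemma Phi_monic : Phi n \is monic.
Proof. exact: monic_map (Cyclotomic_monic n). Qed.

Lemma size_Phi : size (Phi n) = size 'Phi_n.
Proof. by rewrite size_map_poly_id0 // (monicP (Cyclotomic_monic n)) oner_neq0. Qed.

Lemma qeval_Phi : qeval (Phi n) = 0.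
Proof.
have -> : qeval (Phi n) = (map_poly intr 'Phi_n : {poly algC}).[z]%:P.
  rewrite /qeval /= horner_evalE -horner_map /=; congr (_.[_]).
  rewrite /Phi -!map_poly_comp; apply: eq_map_poly => c /=.
  by rewrite !rmorph_int.
rewrite (Cintr_Cyclotomic zn).
have /eqP -> : root (cyclotomic z n) z by rewrite root_cyclotomic.
by [].
Qed.

(** After division by the monic [Phi n], each e-coefficient of the remainder is a rational
    polynomial in q that vanishes at z and has smaller degree than the minimal polynomial of z, so
    it is 0. *)
Lemma ker_qeval f : qeval f = 0 -> divides (Phi n) f.
Proof.
move=> f0; have fE := Pdiv.RingMonic.rdivp_eq Phi_monic f.
set r := Pdiv.Ring.rmodp f (Phi n) in fE.
have r0 : qeval r = 0.
  by move: f0; rewrite fE rmorphD rmorphM /= qeval_Phi mulr0 add0r.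
have szr : (size r < size 'Phi_n)%N.
  by rewrite -size_Phi Pdiv.Ring.ltn_rmodp monic_neq0 // Phi_monic.
suff rE : r = 0 by exists (Pdiv.Ring.rdivp f (Phi n)); rewrite {1}fE rE addr0.
have [m [mE _] mP] := minCpolyP z.
have szm : size m = size 'Phi_n.
  rewrite -(size_map_poly (ratr : rat -> algC)) -mE (minCpoly_cyclotomic zn).
  rewrite -(Cintr_Cyclotomic zn) size_map_poly_id0 //.
  by rewrite (monicP (Cyclotomic_monic n)) oner_neq0.
apply/polyP=> j; apply/polyP=> i; rewrite !coef0.
set ri := \poly_(j < size r) (r`_j)`_i.
have riE : ri = 0.
  have: m %| ri by rewrite -mP /root -coef_qeval r0 coef0.
  apply: contraTeq => ri0; apply: contraL szr => /(dvdp_leq ri0).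
  rewrite szm -leqNgt => h; apply: leq_trans h _; exact: size_poly.
have := congr1 (fun f : {poly rat} => f`_j) riE.
rewrite /ri coef_poly coef0; case: ltnP => // h _.
by rewrite (nth_default 0 h) coef0.
Qed.

End Evaluation.

(** * Arithmetic of d, n and the summation range *)

(** By [range_M'], 2 M' is inverse to d modulo n. The last two fields let both terminations occur
    within the range. In the theorem M = M' if d > 2; for d = 2 one has M' = i + 1, short of 2 i + 1
    as soon as i > 0, and M is 2 i + 1 instead. *)
Record sum_range (d n i M' M : nat) : Prop := SumRange {
  range_n : n = (d + 1 + 2 * d * i)%N;
  range_M' : (2 * d * M' = (d - 1) * n + 1)%N;
  range_M_M' : (M < 2 * M')%N;
  range_M_n : (2 * M < n)%N;
  range_M'_i : (4 * M' + 2 + 4 * i = 2 * n)%N;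
  range_i_n : (4 * i + 2 < n)%N;
  range_M'_M : (M' <= M)%N;
  range_i_M : (2 * i < M)%N }.

(** Multiplying by 2 M' turns the exponent into j + 1 modulo n, which is positive and below n. *)
Lemma ndvd_dj d n i M' M j : sum_range d n i M' M -> (j < M)%N ->
  ~~ (n %| d * j.+1)%N.
Proof.
case=> _ E lt_M_2M' lt_2M_n E4 lt_4i_n _ _; move: (d - 1)%N E => r E.
move=> jM; apply/negP=> H.
have : (n %| 2 * M' * (d * j.+1))%N by rewrite dvdn_mull.
have -> : (2 * M' * (d * j.+1) = r * j.+1 * n + j.+1)%N.
  by have := congr1 (fun x => x * j.+1)%N E; lia.
by rewrite dvdn_addr ?dvdn_mull // => /dvdn_leq; lia.
Qed.

(** Multiplying by M' turns the exponent into j + 1 - 2 M' modulo n, and 0 < 2 M' - (j + 1) < n. *)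
Lemma ndvd_2dj d n i M' M j : sum_range d n i M' M -> (j < M)%N ->
  ~~ (n %| 2 * d * j.+1 - 2)%N.
Proof.
case=> _ E lt_M_2M' lt_2M_n E4 lt_4i_n _ _; move: (d - 1)%N E => r E.
move=> jM; apply/negP=> H.
have d0 : (0 < d)%N by case: (d) E => //; lia.
have w : (2 * d * j.+1 - 2 + 2 = 2 * d * j.+1)%N.
  by rewrite subnK // -mulnA leq_pmulr // muln_gt0 d0.
have H1 : (n %| M' * (2 * d * j.+1 - 2))%N by rewrite dvdn_mull.
have L : (n %| 2 * M' - j.+1)%N.
  rewrite -(dvdn_addr _ H1).
  rewrite (_ : (_ + _ = r * j.+1 * n)%N) ?dvdn_mull //.
  have := congr1 (fun x => x * j.+1)%N E; have := congr1 (fun x => M' * x)%N w.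
  by move: (2 * d * j.+1 - 2)%N => x; lia.
have {}L : (n <= 2 * M' - j.+1)%N by apply: dvdn_leq L; lia.
lia.
Qed.

Lemma ndvd_d2 d n i M' M j : sum_range d n i M' M -> (j < M)%N ->
  ~~ (n %| d + 2 + 2 * d * j)%N.
Proof.
case=> _ E lt_M_2M' lt_2M_n E4 lt_4i_n _ _; move: (d - 1)%N E => r E.
move=> jM; apply/negP=> H.
have : (n %| 2 * M' * (d + 2 + 2 * d * j))%N by rewrite dvdn_mull.
have -> : (2 * M' * (d + 2 + 2 * d * j) =
    r * (2 * j + 1) * n + (2 * j + 1 + 4 * M'))%N.
  by have := congr1 (fun x => x * (2 * j + 1))%N E; lia.
rewrite dvdn_addr ?dvdn_mull // => /dvdnP[k kE].
(* Here k n = 2 n - 1 - 4 i + 2 j lies strictly between n and 3 n, and k = 2 fails by parity. *)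
case: k kE => [|[|[|k]]] kE; lia.
Qed.
Lemma parameter_facts d n (M := (if d == 2 then (n - 1) %/ 2
    else (d * n - n + 1) %/ (2 * d))%N) :
  (2 <= d)%N -> ~~ odd d -> (0 < n)%N -> (n = d + 1 %[mod 2 * d])%N ->
  exists i M', sum_range d n i M' M.
Proof.
move=> d2 dodd n0 hn.
have nE : n = (d + 1 + 2 * d * (n %/ (2 * d)))%N.
  rewrite {1}(divn_eq n (2 * d)) hn modn_small; last by lia.
  by rewrite addnC [(_ * (2 * d))%N]mulnC.
move: (n %/ (2 * d))%N nE => i nE.
(* In terms of g both quotients are exact: M' = g + 1 + (2 g + 1) i, and d = 2 is the case g = 0. *)
have [g dE] : exists g, d = (2 * g + 2)%N.
  by exists (d./2 - 1)%N; have := odd_double_half d; rewrite (negPf dodd); lia.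
have ME : (M = if g == 0 then (2 * i).+1 else g + 1 + 2 * (g * i) + i)%N.
  rewrite /M nE dE; case: g dE => [|g] dE /=.
    by rewrite (_ : (_ - 1 = (2 * i).+1 * 2)%N) ?mulnK //; lia.
  rewrite ifF; last by lia.
  set M' := (g.+1 + 1 + 2 * (g.+1 * i) + i)%N.
  rewrite (_ : (_ + 1 = M' * (2 * (2 * g.+1 + 2)))%N) ?mulnK //; last by lia.
exists i, (g + 1 + 2 * (g * i) + i)%N; rewrite ME nE dE.
split=> //.
- by rewrite addn2 subn1 /=; lia.
- by case: (g) => [|g'] /=; lia.
- by case: (g) => [|g'] /=; lia.
- lia.
- lia.
- by case: (g) => [|g'] /=; lia.
- by case: (g) => [|g'] /=; lia.
Qed.

(** * Polynomials with prescribed roots *)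

Lemma poly_nat_roots_eq0 (F : fieldType) (P : {poly F}) m :
  injective (fun x : nat => x%:R : F) ->
  (forall x, (m <= x)%N -> root P x%:R) -> P = 0.
Proof.
move=> inj hP; apply: contraTeq isT => P0.
have := max_poly_roots (rs := [seq x%:R | x <- iota m (size P)]) P0.
rewrite size_map size_iota ltnn => h; apply: h.
  by apply/allP=> w /mapP[x + ->]; rewrite mem_iota => /andP[mx _]; apply: hP.
by rewrite map_inj_uniq // iota_uniq.
Qed.

Lemma factor_two_roots (F : fieldType) (P : {poly F}) x y :
  root P x -> root P y -> x != y ->
  exists Q, P = Q * ('X - y%:P) * ('X - x%:P).
Proof.
move=> rx ry xy; have [P1 PE] := factor_theorem _ _ rx.
have [Q QE] : exists Q, P1 = Q * ('X - y%:P).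
  apply/factor_theorem.
  move: ry; rewrite PE rootM root_XsubC => /orP[//|/eqP yx].
  by rewrite yx eqxx in xy.
by exists Q; rewrite -QE.
Qed.

Lemma horner_qsum_poly1 (F : fieldType) (a s e p : F) M :
  s != 0 -> wz_generic a s s e p ->
  (qsum_poly a s e p M).[1] =
  (\prod_(0 <= j < M) lin2 (a * p ^+ 2 / s * (p ^+ 2) ^+ j)).[1] *
  \sum_(0 <= k < M.+1) qterm a s s e p k.
Proof.
move=> s0 g; have := @horner_qsum_poly F a s e p M 1 s0 (oner_neq0 F).
by rewrite mulr1 divr1; apply.
Qed.

Lemma horner_two_roots (F : fieldType) (P Q : {poly F}) x y t :
  P = Q * ('X - y%:P) * ('X - x%:P) -> P.[t] = Q.[t] * (t - y) * (t - x).
Proof. by move=> ->; rewrite !hornerM !hornerXsubC. Qed.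

(** Since 1 - X^-1 = -(1 - X)/X, the two linear factors give P^2; the third factor P will come from
    r. *)
Lemma sum_of_two_roots (F : fieldType) (S A r X P G D : F) :
  A != 0 -> X != 0 -> A * S = r * (1 - X^-1) * (1 - X) -> 1 - X = P * G ->
  D * S = P ^+ 2 * (r * (D * - (G ^+ 2) / X / A)).
Proof.
move=> A0 X0 h hX; apply: (mulfI A0); rewrite mulrCA h.
have -> : 1 - X^-1 = - (1 - X) / X by field.
by rewrite hX; field; rewrite A0 X0.
Qed.

(** * Denominators at a root of unity *)

Section RootOfUnity.
Variables (F : fieldType) (y : F) (d n i M' M : nat).
Hypothesis range : sum_range d n i M' M.
Hypothesis y_exp : forall k, (y ^+ k == 1) = (n %| k)%N.

Lemma range_n_gt0 : (0 < n)%N.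
Proof. by have := range_i_n range; lia. Qed.

Lemma unity_neq0 : y != 0.
Proof.
have := y_exp n; rewrite dvdnn; apply: contraTneq => ->.
rewrite expr0n (_ : n == 0%N = false) ?(eq_sym 0) ?oner_eq0 //.
exact: gtn_eqF range_n_gt0.
Qed.

Lemma unity_sub : 1 - y != 0.
Proof.
apply: neq1_sub; rewrite -[y]expr1 y_exp dvdn1.
by apply/eqP=> n1; have := range_i_n range; rewrite n1; lia.
Qed.

Lemma unity_p j : (j < M)%N -> (y ^+ d) ^+ j.+1 != 1.
Proof. by move=> jM; rewrite -exprM y_exp; apply: (ndvd_dj range jM). Qed.

Lemma unity_e f j : (forall k, f * y ^+ k != 1) -> f * (y ^+ d) ^+ j != 1.
Proof. by rewrite -exprM; apply. Qed.

Lemma unity_ae f j : f != 0 -> (forall k, y ^+ k != f) ->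
  y ^+ n.-1 * y ^+ d / f * (y ^+ d) ^+ j != 1.
Proof.
move=> f0 f_exp; apply: contraNneq (f_exp (n.-1 + d + d * j)) => h.
by rewrite !exprD exprM -[f]mul1r -h; apply/eqP; field.
Qed.

Lemma unity_bc j : (j < M)%N -> y ^+ 2 * y ^+ d * ((y ^+ d) ^+ 2) ^+ j != 1.
Proof.
move=> jM; rewrite -!exprM -!exprD y_exp.
have := ndvd_d2 range (j := j).
rewrite (_ : (2 + d + d * (2 * j) = d + 2 + 2 * d * j)%N); last by lia.
by apply.
Qed.

Lemma unity_ab j : (j < M)%N ->
  y ^+ n.-1 * (y ^+ d) ^+ 2 / y * ((y ^+ d) ^+ 2) ^+ j != 1.
Proof.
move=> jM; have y0 := unity_neq0.
apply: contraNneq (ndvd_2dj range jM) => h.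
rewrite -y_exp; apply/eqP.
have d0 : (0 < d)%N by case: (d) (range_M' range) => //; lia.
have yn : y ^+ n = 1 by apply/eqP; rewrite y_exp.
(* The element in [h] is y^(2d(j+1) - 2); the factor y^2 avoids the subtraction. *)
apply: (mulfI (expf_neq0 2 y0)).
rewrite mulr1 -exprD subnKC; last by rewrite -mulnA leq_pmulr // muln_gt0 d0.
rewrite -[LHS]mul1r -yn -exprD -[n in LHS](prednK range_n_gt0).
rewrite (_ : (_ + _ = 1 + (n.-1 + (d * 2 + d * (2 * j))))%N); last by lia.
rewrite exprD [in LHS]exprD [in LHS]exprD expr1 expr2; congr (_ * _).
by rewrite -[RHS]mul1r -h !exprM; field.
Qed.

Lemma unity_a : y ^+ n.-1 = y^-1.
Proof.
apply: (mulfI unity_neq0); rewrite divff ?unity_neq0 // -exprS (prednK range_n_gt0).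
by apply/eqP; rewrite y_exp.
Qed.

Lemma unity_2dM' : y ^+ (2 * d * M') = y.
Proof.
have yn : y ^+ n = 1 by apply/eqP; rewrite y_exp.
by rewrite (range_M' range) exprD mulnC exprM yn expr1n mul1r.
Qed.
End RootOfUnity.

Lemma qterm_summand (F : fieldType) (Q f : F) (d k : nat) : Q != 0 ->
  (1 - Q ^ (3 * d%:Z * k%:Z - 1)) / (1 - Q) *
     ((qpochs [:: Q ^ (-1); f; Q ^ (d%:Z - 1) / f] (Q ^ (2 * d%:Z)) k *
       qpochs [:: Q; Q; Q ^ (d%:Z - 3)] (Q ^ d%:Z) k * Q ^ (d%:Z * k%:Z)) /
      (qpochs [:: Q ^ d%:Z; f; Q ^ (d%:Z - 1) / f] (Q ^ d%:Z) k *
       qpochs [:: Q ^ (2 * d%:Z - 2); Q ^ (2 * d%:Z - 2); Q ^ (d%:Z + 2)]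
         (Q ^ (2 * d%:Z)) k)) =
  (1 - Q)^-1 * qterm (Q ^ (-1)) Q Q f (Q ^+ d) k.
Proof.
move=> Q0; have QD m m' : Q ^ (m + m') = Q ^ m * Q ^ m' by rewrite expfzDr.
have -> : Q ^ (3 * d%:Z * k%:Z - 1) = Q ^ (-1) * (Q ^+ d) ^+ (3 * k).
  by rewrite -exprM exprnP -QD; congr (Q ^ _); lia.
have -> : Q ^ (2 * d%:Z) = (Q ^+ d) ^+ 2.
  by rewrite -exprM exprnP; congr (Q ^ _); lia.
have -> : Q ^ (d%:Z * k%:Z) = (Q ^+ d) ^+ k by rewrite -exprM.
have -> : Q ^ (d%:Z - 1) / f = Q ^ (-1) * Q ^+ d / f by rewrite QD [Q ^ d * _]mulrC.
have -> : Q ^ (d%:Z - 3) = Q ^ (-1) * Q ^+ d / (Q * Q).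
  have -> : d%:Z - 3 = -1 + d%:Z - 1 - 1 :> int by lia.
  by rewrite !QD -exprnP -mulrA invfM.
have -> : Q ^ (2 * d%:Z - 2) = Q ^ (-1) * (Q ^+ d) ^+ 2 / Q.
  have -> : 2 * d%:Z - 2 = -1 + (d * 2)%N%:Z - 1 :> int by lia.
  by rewrite !QD -exprnP exprM.
have -> : Q ^ (d%:Z + 2) = Q * Q * Q ^+ d by rewrite QD mulrC.
rewrite /qpochs !big_cons !big_nil !mulr1 /qterm -exprnP.
rewrite -!mulrA [(1 - Q)^-1 * _]mulrCA; congr (_ * (_ * _)).
Qed.

(** * Roots, residues and the final congruence *)

Section Assembly.
Local Notation K := {fraction Qqe}.
Local Notation tofrac := (@FracField.tofrac _).
Variables d n i M' M : nat.
Hypothesis d2 : (2 <= d)%N.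
Hypothesis dodd : ~~ odd d.
Hypothesis range : sum_range d n i M' M.

Lemma natrK_inj : injective (fun x : nat => x%:R : K).
Proof.
move=> x y /eqP; rewrite -[x%:R](rmorph_nat tofrac) -[y%:R](rmorph_nat tofrac).
rewrite tofrac_eq !natr_Qqe.
by rewrite !(inj_eq (@polyC_inj _)) Num.Theory.eqr_nat => /eqP.
Qed.

(** At each integer X >= 2 the sum terminates in a and vanishes, which gives infinitely many roots.
    Such an integer is never a power of q, so genericity comes for free. *)
Lemma qsum_poly_shift_eq0 :
  qsum_poly (q ^ (- (2 * d * M')%N%:Z)) q e (q ^+ d) M = 0.
Proof.
apply: (@poly_nat_roots_eq0 _ _ 2 natrK_inj) => x x2.
have x0 : (0 < x)%N by exact: ltnW.
have x1 : x <> 1%N by move=> x1; rewrite x1 in x2.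
have g : wz_generic (q ^ (- (2 * d * M')%N%:Z)) (q * x%:R) (q / x%:R) e (q ^+ d).
  have := @wz_generic_q (- (2 * d * M')%N%:Z) 1 1 d x; rewrite expr1z.
  by apply => //; exact: ltnW.
have qj j : q * x%:R * (q ^+ d) ^+ j = q ^ (1 + (d * j)%N%:Z) * x%:R.
  by rewrite qzD expr1z -exprM mulrAC.
rewrite /root horner_qsum_poly //.
- rewrite (qsum_a_terminating (i := M') g) ?mulr0 ?ltnS ?(range_M'_M range) //.
  + rewrite -exprM exprnP -qzD.
    by rewrite (_ : _ + _ = 0) ?expr0z //; lia.
  + move=> j; rewrite qj; exact: qz_natr_eq1.
  + move=> j; rewrite qj; exact: qz_natr_neq_e.
- exact: q_neq0.
- by rewrite natrK_eq0 -lt0n.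
Qed.

(** As n - 1 = d (2 i + 1), the parameter q^(1 - n) is p^-(2i+1); it is c at X = q^n and b at X =
    q^-n, and the term is symmetric in b and c. *)
Lemma root_qsum_poly (m : int) : m = n%:Z \/ m = - n%:Z ->
  root (qsum_poly (q ^ (-1)) q e (q ^+ d) M) (q ^ m).
Proof.
(* Since d is even, n is odd, and so are the exponents that must not vanish for b and c. *)
have [h dE] : exists h, d = (2 * h)%N.
  by exists d./2; have := odd_double_half d; rewrite (negPf dodd); lia.
have gen (b c : int) : (b = 1 + n%:Z /\ c = 1 - n%:Z) \/
    (b = 1 - n%:Z /\ c = 1 + n%:Z) ->
    wz_generic (q ^ (-1)) (q ^ b) (q ^ c) e (q ^+ d).
  move=> bc; have := @wz_generic_q (-1) b c d 1; rewrite mulr1 divr1.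

  apply => //; first exact: ltnW.
  1,2: move=> j _. 3: move=> j.
  1,2,3: by case: bc => -[bE cE]; rewrite ?bE ?cE ?(range_n range) dE; lia.
have g1 := gen _ _ (or_intror (conj erefl erefl)).
have g2 := gen _ _ (or_introl (conj erefl erefl)).
have sum0 : \sum_(0 <= k < M.+1) qterm (q ^ (-1)) (q ^ (1 - n%:Z))
    (q ^ (1 + n%:Z)) e (q ^+ d) k = 0.
  apply: (qsum_b_terminating (i := i) g1); rewrite ?ltnS ?(range_i_M range) //.
  rewrite -exprM exprnP -qzD (_ : _ + _ = 0) ?expr0z //.
  by rewrite (range_n range); lia.
have qq c : q * q ^ c = q ^ (1 + c) by rewrite qzD expr1z.
have qd c : q / q ^ c = q ^ (1 - c) by rewrite qzD qzN expr1z.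
move=> mE; rewrite /root horner_qsum_poly; last 1 first.
- by rewrite qq qd; case: mE => ->; rewrite ?opprK.
- rewrite qq qd; case: mE => ->; last by rewrite opprK sum0 mulr0.
  by rewrite (eq_bigr _ (fun k _ => qtermC _ _ _ _ _ k)) sum0 mulr0.
- exact: q_neq0.
- by rewrite expfz_neq0 // q_neq0.
Qed.

Variable z : algC.
Hypothesis zn : n.-primitive_root z.
Local Notation ev := (qeval z).
Local Notation y := (@FracField.tofrac {poly algC} z%:P).
Local Notation f := (@FracField.tofrac {poly algC} 'X).

Lemma specializes_q : specializes ev q y.
Proof. by have := specializes_tofrac ev 'X; rewrite /= qevalX. Qed.

Lemma specializes_e : specializes ev e f.
Proof. by have := specializes_tofrac ev 'X%:P; rewrite /= qevalE. Qed.

Lemma tofracXz k : y ^+ k = tofrac (z ^+ k)%:P.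
Proof. by rewrite polyC_exp (rmorphXn tofrac). Qed.

Lemma y_exp k : (y ^+ k == 1) = (n %| k)%N.
Proof.
rewrite tofracXz -(rmorph1 tofrac) tofrac_eq -polyC1 (inj_eq (@polyC_inj _)).
by rewrite (prim_order_dvd zn).
Qed.

Lemma f_neq0 : f != 0.
Proof. by rewrite tofrac_eq0 polyX_eq0. Qed.

Lemma f_exp1 k : f * y ^+ k != 1.
Proof.
rewrite tofracXz -(rmorphM tofrac) -(rmorph1 tofrac) tofrac_eq.
apply/eqP=> /(congr1 (fun p : {poly algC} => p`_0)).
by rewrite coefXM coef1 /= => /esym /eqP; rewrite oner_eq0.
Qed.

Lemma f_exp k : y ^+ k != f.
Proof.
rewrite tofracXz tofrac_eq; apply/eqP=> /(congr1 (fun p : {poly algC} => p`_1)).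
by rewrite coefX coefC /= => /esym /eqP; rewrite oner_eq0.
Qed.

Lemma y_neq0 : y != 0.
Proof. exact: (unity_neq0 range y_exp). Qed.

Lemma specializes_qV : specializes ev (q ^ (-1)) (y ^+ n.-1).
Proof.
rewrite (unity_a range y_exp); have := specializesV y_neq0 specializes_q.
by rewrite exprN1.
Qed.

(** The reduction depends on a only through its residue, which is the same for q^-1 and
    q^(-2dM'). *)
Lemma pspecializes_qsum a : specializes ev a (y ^+ n.-1) ->
  pspecializes ev (qsum_poly a q e (q ^+ d) M)
    (qsum_poly (y ^+ n.-1) y f (y ^+ d) M).
Proof.
move=> ha; have hq := specializes_q.
apply: pspecializes_qsum_poly => //.
- exact: specializes_e.
- exact: specializesX.
- exact: y_neq0.
- exact: f_neq0.
- by move=> j; exact: (unity_p range y_exp).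
- by move=> j; apply: unity_e f_exp1.
- by move=> j; apply: unity_ae f_neq0 f_exp.
- by move=> j; exact: (unity_bc range y_exp).
Qed.

Lemma pspecializes_qsum0 : pspecializes ev (qsum_poly (q ^ (-1)) q e (q ^+ d) M) 0.
Proof.
have h : specializes ev (q ^ (- (2 * d * M')%N%:Z)) (y ^+ n.-1).
  rewrite (unity_a range y_exp) -[in y^-1](unity_2dM' range y_exp) -exprnN.
  apply: specializesV; last exact: specializesX specializes_q.
  by rewrite (unity_2dM' range y_exp) y_neq0.
have := pspecializes_qsum h; rewrite qsum_poly_shift_eq0 => h0 k.
have := pspecializes_qsum specializes_qV k; have := h0 k; rewrite !coef0 => hk.
by rewrite (specializes_uniq hk (specializes0 ev)).
Qed.

Definition qsum_common_den : K :=
  (\prod_(0 <= j < M) lin2 (q ^ (-1) * (q ^+ d) ^+ 2 / q * ((q ^+ d) ^+ 2) ^+ j)).[1].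

Lemma specializes_common_den :
  exists2 v, v != 0 & specializes ev qsum_common_den v.
Proof.
pose u := y ^+ n.-1 * (y ^+ d) ^+ 2 / y.
exists (qpoch u ((y ^+ d) ^+ 2) M * qpoch u ((y ^+ d) ^+ 2) M).
  by rewrite -expr2 expf_neq0 //; apply: qpoch_neq0 => j; apply: (unity_ab range y_exp).
rewrite /qsum_common_den horner_lin2_prod ?oner_neq0 // expr1n mul1r mulr1 divr1.
have h : specializes ev (q ^ (-1) * (q ^+ d) ^+ 2 / q) u.
  apply: specializes_div; [exact: y_neq0| |exact: specializes_q].
  apply: specializesM; first exact: specializes_qV.
  by do 2!apply: specializesX; apply: specializes_q.
by apply: specializesM; apply: specializes_qpoch => //; do 2!apply: specializesX;
  apply: specializes_q.
Qed.

Lemma horner1_qsum_poly : (qsum_poly (q ^ (-1)) q e (q ^+ d) M).[1] =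
  qsum_common_den * \sum_(0 <= k < M.+1) qterm (q ^ (-1)) q q e (q ^+ d) k.
Proof.
have := @wz_generic_q (-1) 1 1 d 1; rewrite expr1z !mulr1 divr1 => g.
apply: horner_qsum_poly1; first exact: q_neq0.
apply: g => //; first exact: ltnW.
all: move=> j; try move=> _; have : (0 <= (d * j)%N)%N by [].
all: lia.
Qed.

Lemma one_sub_qn : exists G, 1 - q ^+ n = tofrac (Phi n) * tofrac G.
Proof.
have n0 := range_n_gt0 range.
exists (- \prod_(k <- rem n (divisors n)) map_poly intr 'Phi_k).
rewrite -(rmorphM tofrac) mulrN /Phi.
have h : (\prod_(k <- divisors n) map_poly intr 'Phi_k : Qqe) = 'X^n - 1.
  by rewrite -rmorph_prod prod_Cyclotomic // rmorphB rmorph1 /= map_polyXn.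
rewrite (big_rem n) ?divisors_id //= in h.
by rewrite h opprB rmorphB rmorph1 (rmorphXn tofrac).
Qed.

Lemma qsum_frac_congr : frac_congr (Phi n ^+ 3)
  ((1 - q)^-1 * \sum_(0 <= k < M.+1) qterm (q ^ (-1)) q q e (q ^+ d) k) 0.
Proof.
have n0 := range_n_gt0 range.
have rP := root_qsum_poly (or_introl erefl).
have rN := root_qsum_poly (or_intror erefl).
have qnn : q ^ n%:Z != q ^ (- n%:Z).
  apply: contraTneq n0 => h; have : q ^ (n%:Z + n%:Z) = 1%:R.
    by rewrite qzD {1}h -qzD addNr.
  by move=> /qz_natr; lia.
have [Q PE] := factor_two_roots rP rN qnn.
have yn : y ^+ n = 1 by apply/eqP; rewrite y_exp.
have hq := specializesX n (specializes_q).
have hqN : specializes ev (q ^ (- n%:Z)) (y ^+ n)^-1.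
  by rewrite qzN; apply: (specializesV _ hq); rewrite yn oner_neq0.
(* Both roots have residue 1, so they are separated only before reduction; the factors are therefore
   split off over Q(q, e) and residue 0 is carried through each division. *)
have hQ : pspecializes ev Q 0.
  apply: (pspecializes0_root hqN (erefl _)).
  exact: (pspecializes0_root hq PE pspecializes_qsum0).
have [v v0 hv] := specializes_common_den.
have den0 : qsum_common_den != 0.
  apply: contraNneq v0 => den0; rewrite den0 in hv.
  by rewrite (specializes_uniq hv (specializes0 ev)).
have [G GE] := one_sub_qn.
have SE : qsum_common_den * \sum_(0 <= k < M.+1) qterm (q ^ (-1)) q q e (q ^+ d) k =
    Q.[1] * (1 - (q ^+ n)^-1) * (1 - q ^+ n).
  by rewrite -horner1_qsum_poly (horner_two_roots 1 PE) qzN.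
have qn0 : q ^+ n != 0 := expf_neq0 n q_neq0.
rewrite (sum_of_two_roots _ den0 qn0 SE GE).
have Phi0 : Phi n != 0 by rewrite monic_neq0 // Phi_monic.
apply: (frac_congr_specializes0 Phi0 (qeval_Phi zn) (ker_qeval zn) Qqe_measure_lt).
have y1 : 1 - y != 0 := unity_sub range y_exp.
have := specializes_horner hQ (specializes1 ev); rewrite horner0 => hQ1.
rewrite -[X in specializes _ _ X]
  (mul0r ((1 - y)^-1 * - (tofrac (ev G) ^+ 2) / y ^+ n / v)).
apply: (specializesM hQ1); apply: (specializes_div v0 _ hv).
have yn0 : y ^+ n != 0 by rewrite yn oner_neq0.
apply: (specializes_div yn0 _ hq); apply: specializesM.
  apply: (specializesV y1); apply: specializesB; first exact: specializes1.
  exact: specializes_q.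
by apply: specializesN; apply: specializesX; apply: specializes_tofrac.
Qed.
End Assembly.

Theorem theorem1p3 (d n : nat) (hd2 : (2 <= d)%N) (hd : ~~ odd d)
    (hn0 : (0 < n)%N) (hn : (n = d + 1 %[mod 2 * d])%N) :
  let M := (if d == 2 then (n - 1) %/ 2 else (d * n - n + 1) %/ (2 * d))%N in
  frac_congr (Phi n ^+ 3)
    (\sum_(0 <= k < M.+1)
       qint (3 * d%:Z * k%:Z - 1) *
       ((qpochs [:: q ^ (-1); e; q ^ (d%:Z - 1) / e] (q ^ (2 * d%:Z)) k *
         qpochs [:: q; q; q ^ (d%:Z - 3)] (q ^ d%:Z) k *
         q ^ (d%:Z * k%:Z)) /
        (qpochs [:: q ^ d%:Z; e; q ^ (d%:Z - 1) / e] (q ^ d%:Z) k *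
         qpochs [:: q ^ (2 * d%:Z - 2); q ^ (2 * d%:Z - 2); q ^ (d%:Z + 2)]
           (q ^ (2 * d%:Z)) k)))
    0.
Proof.
move=> M; have [i [M' range]] := parameter_facts hd2 hd hn0 hn.
have [z zn] := C_prim_root_exists hn0.
rewrite (eq_bigr _ (fun k _ => qterm_summand e d k q_neq0)) -mulr_sumr.
exact: qsum_frac_congr hd2 hd range z zn.
Qed.
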